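(* Let $(\mathfrak{g},[\cdot,\cdot],\alpha)$ be a regular hom-Lie algebra, $(V,\beta,\rho)$ a representation with $\beta$ invertible, and $T:V\to\mathfrak{g}$ an $\mathcal{O}$-operator on $(\mathfrak{g},[\cdot,\cdot],\alpha)$ with respect to $(V,\beta,\rho)$. For any element $x\in\mathsf{Nij}(T)$, the sum $T_t=T+t\mathfrak{T}$ with $\mathfrak{T}:=\delta_T(x)$ is a linear deformation of $T$ and it is a trivial deformation of $T$.
   Context: The base field $k$ has characteristic zero. A (multiplicative) hom-Lie algebra $(\mathfrak{g},[\cdot,\cdot],\alpha)$ is a vector space $\mathfrak{g}$ with a skew-symmetric bilinear bracket and a linear map $\alpha:\mathfrak{g}\to\mathfrak{g}$ with $\alpha[x,y]=[\alpha(x),\alpha(y)]$ and $[\alpha(x),[y,z]]+[\alpha(y),[z,x]]+[\alpha(z),[x,y]]=0$; it is regular if $\alpha$ is invertible. A representation $(V,\beta,\rho)$ is a vector space $V$, $\beta\in\mathrm{End}(V)$ and a linear map $\rho:\mathfrak{g}\to\mathrm{End}(V)$ with $\rho(\alpha(x))(\beta(v))=\beta(\rho(x)(v))$ and $\rho([x,y])(\beta(v))=\rho(\alpha(x))\rho(y)(v)-\rho(\alpha(y))\rho(x)(v)$. Write $\{x,v\}:=\rho(x)(v)$. An $\mathcal{O}$-operator on $(\mathfrak{g},[\cdot,\cdot],\alpha)$ with respect to $(V,\beta,\rho)$ is a linear map $T:V\to\mathfrak{g}$ with $T\circ\beta=\alpha\circ T$ and $[Tu,Tv]=T(\{Tu,v\}-\{Tv,u\})$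 for all $u,v\in V$. For $x\in\mathfrak{g}$ with $\alpha(x)=x$, $\delta_T(x):V\to\mathfrak{g}$ is $\delta_T(x)(v)=[T\beta^{-1}(v),x]+T\{x,\beta^{-1}(v)\}$. A linear deformation of $T$ generated by a linear map $\mathfrak{T}:V\to\mathfrak{g}$ with $\mathfrak{T}\circ\beta=\alpha\circ\mathfrak{T}$ is $T_t=T+t\mathfrak{T}$ such that $T_t$ is an $\mathcal{O}$-operator on $(\mathfrak{g},[\cdot,\cdot],\alpha)$ with respect to $(V,\beta,\rho)$ for all $t\in k$. A homomorphism from an $\mathcal{O}$-operator $T$ to an $\mathcal{O}$-operator $T'$ (both with respect to $(V,\beta,\rho)$) is a pair $(\phi_{\mathfrak{g}},\phi_V)$ with $\phi_{\mathfrak{g}}:\mathfrak{g}\to\mathfrak{g}$ a hom-Lie algebra homomorphism (linear, preserving the bracket and commuting with $\alpha$) and $\phi_V:V\to V$ linear such that $T'\circ\phi_V=\phi_{\mathfrak{g}}\circ T$, $\phi_V\circ\beta=\beta\circ\phi_V$ and $\phi_V(\rho(y)(v))=\rho(\phi_{\mathfrak{g}}(y))(\phi_V(v))$ for all $y\in\mathfrak{g},v\in V$. For $x$ with $\alpha(x)=x$ put $\mathrm{ad}_x^\dagger(y)=\alpha^{-1}([x,y])$ and $\rho(x)^\dagger(v)=\beta^{-1}(\rho(x)(v))$. Two linear deformations $T^1_t=T+t\mathfrak{T}_1$, $T^2_t=T+t\mathfrak{T}_2$ are equivalent if there is $x\in\mathfrak{g}$ with $\alpha(x)=x$ such that $(\mathrm{Id}_{\mathfrak{g}}+t\,\mathrm{ad}_x^\dagger,\mathrm{Id}_V+t\rho(x)^\dagger)$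 is a homomorphism from $T^1_t$ to $T^2_t$ (for all $t$). A linear deformation $T_t$ is trivial if it is equivalent to $T_0=T$ (take $T^1_t=T_t$, $T^2_t=T$). $\mathsf{Nij}(T)$ is the set of Nijenhuis elements associated to $T$, i.e. of $x\in\mathfrak{g}$ with $\alpha(x)=x$, $[[x,y],[x,z]]=0$ for all $y,z\in\mathfrak{g}$, $\rho([x,y])\rho(x)(v)=0$ for all $y\in\mathfrak{g},v\in V$, and $[x,T\rho(x)(v)+[T(v),x]]=0$ for all $v\in V$. *)

(* Defs.v *)
From HB Require Import structures.
From mathcomp Require Import all_boot all_order all_algebra.

Set Implicit Arguments.
Unset Strict Implicit.
Unset Printing Implicit Defensive.

Import GRing.Theory.
Local Open Scope ring_scope.

Lemma bij_preim (A B : eqType) (f : A -> B) :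
  bijective f -> forall y, exists x, f x == y.
Proof. by case=> g _ gK y; exists (g y); rewrite gK. Qed.

(* No Prop-to-Type elimination is available to extract the inverse from      *)
(* [bijective f], hence the choice operator of A; see bij_invK, bij_invVK.   *)
Definition bij_inv (A : choiceType) (B : eqType) (f : A -> B)
    (f_bij : bijective f) (y : B) : A :=
  xchoose (bij_preim f_bij y).

Lemma bij_invVK (A : choiceType) (B : eqType) (f : A -> B)
  (f_bij : bijective f) : cancel (bij_inv f_bij) f.
Proof. by move=> y; apply/eqP/(xchooseP (bij_preim f_bij y)). Qed.

Lemma bij_invK (A : choiceType) (B : eqType) (f : A -> B)
  (f_bij : bijective f) : cancel f (bij_inv f_bij).
Proof. by move=> x; apply: (bij_inj f_bij); rewrite bij_invVK. Qed.

Record hom_lie (k : fieldType) (g : lmodType k) := HomLie {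
  bracket : {bilinear g -> g -> g};
  twist : {linear g -> g};
  bracket_skew : forall x y, bracket x y = - bracket y x;
  twist_bracket : forall x y,
    twist (bracket x y) = bracket (twist x) (twist y);
  hom_jacobi : forall x y z,
    bracket (twist x) (bracket y z) + bracket (twist y) (bracket z x)
      + bracket (twist z) (bracket x y) = 0
}.

Definition regular (k : fieldType) (g : lmodType k) (L : hom_lie g) : Prop :=
  bijective (twist L).

(* The linear map rho : g -> End(V) is given in curried form.                *)
Record hom_lie_rep (k : fieldType) (g : lmodType k) (L : hom_lie g)
    (V : lmodType k) := HomLieRep {
  beta : {linear V -> V};
  rho : {bilinear g -> V -> V};
  rho_twist : forall x v, rho (twist L x) (beta v) = beta (rho x v);
  rho_bracket : forall x y v,
    rho (bracket L x y) (beta v)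
      = rho (twist L x) (rho y v) - rho (twist L y) (rho x v)
}.

Record O_operator (k : fieldType) (g : lmodType k) (L : hom_lie g)
    (V : lmodType k) (M : hom_lie_rep L V) (T : V -> g) : Prop := IsOOperator {
  O_linear : linear T;
  O_beta : forall v, T (beta M v) = twist L (T v);
  O_bracket : forall u v,
    bracket L (T u) (T v) = T (rho M (T u) v - rho M (T v) u)
}.

Definition delta (k : fieldType) (g : lmodType k) (L : hom_lie g)
    (V : lmodType k) (M : hom_lie_rep L V) (beta_bij : bijective (beta M))
    (T : V -> g) (x : g) (v : V) : g :=
  let w := bij_inv beta_bij v in bracket L (T w) x + T (rho M x w).

Record Nij (k : fieldType) (g : lmodType k) (L : hom_lie g)
    (V : lmodType k) (M : hom_lie_rep L V) (T : V -> g) (x : g) : Prop :=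
  IsNij {
  Nij_fix : twist L x = x;
  Nij_bracket : forall y z, bracket L (bracket L x y) (bracket L x z) = 0;
  Nij_rho : forall y v, rho M (bracket L x y) (rho M x v) = 0;
  Nij_T : forall v, bracket L x (T (rho M x v) + bracket L (T v) x) = 0
}.

Definition deform (k : fieldType) (V g : lmodType k) (T D : V -> g) (t : k)
    (v : V) : g :=
  T v + t *: D v.

Record linear_deformation (k : fieldType) (g : lmodType k) (L : hom_lie g)
    (V : lmodType k) (M : hom_lie_rep L V) (T D : V -> g) : Prop :=
  IsLinearDeformation {
  def_linear : linear D;
  def_beta : forall v, D (beta M v) = twist L (D v);
  def_O : forall t : k, O_operator M (deform T D t)
}.

Record O_hom (k : fieldType) (g : lmodType k) (L : hom_lie g)
    (V : lmodType k) (M : hom_lie_rep L V) (T T' : V -> g)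
    (phig : g -> g) (phiV : V -> V) : Prop := IsOHom {
  hom_src : O_operator M T;
  hom_tgt : O_operator M T';
  homg_linear : linear phig;
  homg_bracket : forall y z,
    phig (bracket L y z) = bracket L (phig y) (phig z);
  homg_twist : forall y, phig (twist L y) = twist L (phig y);
  homV_linear : linear phiV;
  hom_T : forall v, T' (phiV v) = phig (T v);
  homV_beta : forall v, phiV (beta M v) = beta M (phiV v);
  homV_rho : forall y v, phiV (rho M y v) = rho M (phig y) (phiV v)
}.

Definition ad_dag (k : fieldType) (g : lmodType k) (L : hom_lie g)
    (twist_bij : regular L) (x y : g) : g :=
  bij_inv twist_bij (bracket L x y).

Definition rho_dag (k : fieldType) (g : lmodType k) (L : hom_lie g)
    (V : lmodType k) (M : hom_lie_rep L V) (beta_bij : bijective (beta M))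
    (x : g) (v : V) : V :=
  bij_inv beta_bij (rho M x v).

(* x is chosen before t: one element serves for all values of the parameter. *)
Definition equivalent_deformations (k : fieldType) (g : lmodType k)
    (L : hom_lie g) (twist_bij : regular L) (V : lmodType k)
    (M : hom_lie_rep L V) (beta_bij : bijective (beta M))
    (T D1 D2 : V -> g) : Prop :=
  [/\ linear_deformation M T D1, linear_deformation M T D2 &
      exists2 x : g, twist L x = x &
        forall t : k,
          O_hom M (deform T D1 t) (deform T D2 t)
            (fun y => y + t *: ad_dag twist_bij x y)
            (fun v => v + t *: rho_dag beta_bij x v)].

(* The deformation generated by 0 is the constant one, T_t = T.              *)
Definition trivial_deformation (k : fieldType) (g : lmodType k)
    (L : hom_lie g) (twist_bij : regular L) (V : lmodType k)
    (M : hom_lie_rep L V) (beta_bij : bijective (beta M))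
    (T D : V -> g) : Prop :=
  equivalent_deformations twist_bij beta_bij T D (fun=> 0).

(* Main.v *)
Require Import Defs.
From HB Require Import structures.
From mathcomp Require Import all_boot all_order all_algebra.

Set Implicit Arguments.
Unset Strict Implicit.
Unset Printing Implicit Defensive.

Import GRing.Theory.
Local Open Scope ring_scope.

(** Write N = ad_x^dagger, R = rho(x)^dagger and D = delta_T(x).  Then N and R
    are derivations of the bracket and of the action, D = T R - N T, and the
    Nijenhuis conditions say that [N y, N z] = 0, rho(N y) (R v) = 0 and
    N D = 0.  Hence phi = 1 + tN and psi = 1 + tR are compatible with the
    bracket and the action, and phi T_t = T psi.  It follows that phi kills the
    defect E of T_t from being an O-operator.  Since D is a cocycle and
    N D = 0, also N E = 0, so that E = phi E = 0. *)

Section InverseTwist.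

Variables (k : fieldType) (g : lmodType k) (L : hom_lie g).
Variables (twist_bij : regular L) (V : lmodType k) (M : hom_lie_rep L V).
Variables (beta_bij : bijective (beta M)) (x : g).

Lemma bij_inv_linear (U W : lmodType k) (f : {linear U -> W})
  (f_bij : bijective f) : linear (bij_inv f_bij).
Proof. exact: can2_linear (bij_invK f_bij) (bij_invVK f_bij). Qed.

Lemma ad_dag_linear : linear (ad_dag twist_bij x).
Proof. by move=> a y z; rewrite /ad_dag linearPr bij_inv_linear. Qed.

HB.instance Definition _ :=
  GRing.isLinear.Build k g g *:%R (ad_dag twist_bij x) ad_dag_linear.

Lemma rho_dag_linear : linear (rho_dag beta_bij x).
Proof. by move=> a u v; rewrite /rho_dag linearPr bij_inv_linear. Qed.

HB.instance Definition _ :=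
  GRing.isLinear.Build k V V *:%R (rho_dag beta_bij x) rho_dag_linear.

Local Notation N := (ad_dag twist_bij x).
Local Notation R := (rho_dag beta_bij x).
Local Notation br := (bracket L).
Local Notation act := (rho M).

Lemma twist_ad_dag y : twist L (N y) = br x y.
Proof. exact: bij_invVK. Qed.

Lemma beta_rho_dag v : beta M (R v) = act x v.
Proof. exact: bij_invVK. Qed.

Hypothesis x_fix : twist L x = x.

(** Since [twist L] fixes [x], it slides through the bracket with [x]. With [twist_ad_dag], this
    makes [N] commute with [twist L]. *)
Lemma ad_dag_twist y : N (twist L y) = br x y.
Proof. by rewrite /ad_dag -{1}x_fix -twist_bracket bij_invK. Qed.

Lemma rho_dag_beta v : R (beta M v) = act x v.
Proof. by rewrite /rho_dag -{1}x_fix rho_twist bij_invK. Qed.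

(** After applying the injective [twist L], this is the hom-Jacobi identity for [x], [y], [z] with
    [x] fixed by the twist. *)
Lemma ad_dag_bracket y z : N (br y z) = br (N y) z + br y (N z).
Proof.
apply: (bij_inj twist_bij).
rewrite linearD !twist_bracket !twist_ad_dag.
have /eqP := hom_jacobi L x y z.
rewrite x_fix -addrA addr_eq0 => /eqP ->.
by rewrite opprD addrC [br z x]bracket_skew linearNr opprK -bracket_skew addrC.
Qed.

Lemma rho_dag_act y v : R (act y v) = act (N y) v + act y (R v).
Proof.
apply: (bij_inj beta_bij).
rewrite linearD -!rho_twist twist_ad_dag !beta_rho_dag rho_bracket x_fix.
by rewrite subrK.
Qed.

(** Substituting [v = beta w] removes the inverse of [beta] from [delta]. In this form [delta]
    measures how far [T] is from intertwining the derivations [R] and [N]. *)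
Lemma delta_dagE (T : V -> g) (HT : O_operator M T) v :
  delta beta_bij T x v = T (R v) - N (T v).
Proof.
rewrite /delta /= -[in RHS](bij_invVK beta_bij v) rho_dag_beta.
by rewrite (O_beta HT) ad_dag_twist bracket_skew addrC.
Qed.

End InverseTwist.

Section SkewAction.

Variables (k : fieldType) (g : lmodType k) (L : hom_lie g).
Variables (V : lmodType k) (M : hom_lie_rep L V).

Local Notation act := (rho M).

(** For an O-operator [S], this is the product on [V] that [S] maps to the bracket. Allowing any map
    [S] lets it be expanded in powers of [t]. *)
Definition skew_act (S : V -> g) (u v : V) : V := act (S u) v - act (S v) u.

Lemma skew_act_deform (T D : V -> g) t u v :
  skew_act (deform T D t) u v = skew_act T u v + t *: skew_act D u v.
Proof.
rewrite /skew_act /deform !linearDl !linearZl_LR opprD.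
by rewrite addrACA scalerBr.
Qed.

End SkewAction.

Section NijenhuisDeformation.

Variables (k : fieldType) (g : lmodType k) (L : hom_lie g).
Variables (twist_bij : regular L) (V : lmodType k) (M : hom_lie_rep L V).
Variables (beta_bij : bijective (beta M)) (T : {linear V -> g}).
Variables (HT : O_operator M T) (x : g) (Hx : Nij M T x).

Local Notation N := (ad_dag twist_bij x).
Local Notation R := (rho_dag beta_bij x).
Local Notation D := (delta beta_bij T x).
Local Notation br := (bracket L).
Local Notation act := (rho M).
Local Notation x_fix := (Nij_fix Hx).
Local Notation phi t := (fun y : g => y + t *: N y).
Local Notation psi t := (fun v : V => v + t *: R v).

Lemma delta_linear : linear D.
Proof.
move=> a u v; rewrite !(delta_dagE twist_bij _ x_fix HT) !linearP.
by rewrite scalerDr addrACA.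
Qed.

HB.instance Definition _ := GRing.isLinear.Build k V g *:%R D delta_linear.

Lemma delta_beta v : D (beta M v) = twist L (D v).
Proof.
rewrite !(delta_dagE twist_bij _ x_fix HT) rho_dag_beta ?x_fix //.
rewrite linearB -(O_beta HT) beta_rho_dag twist_ad_dag.
by rewrite (O_beta HT) ad_dag_twist ?x_fix.
Qed.

Lemma deform_linear t : linear (deform T D t).
Proof.
by move=> a u v; rewrite /deform !linearP scalerDr addrACA.
Qed.

Lemma phi_linear t : linear (phi t).
Proof.
by move=> a u v /=; rewrite !linearP scalerDr addrACA.
Qed.

Lemma psi_linear t : linear (psi t).
Proof.
by move=> a u v /=; rewrite !linearP scalerDr addrACA.
Qed.

Lemma ad_dag_bracket0 y z : br (N y) (N z) = 0.
Proof.
apply: (bij_inj twist_bij).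
by rewrite twist_bracket !twist_ad_dag linear0 (Nij_bracket Hx).
Qed.

Lemma act_dag0 y v : act (N y) (R v) = 0.
Proof.
apply: (bij_inj beta_bij).
by rewrite -rho_twist twist_ad_dag beta_rho_dag linear0 (Nij_rho Hx).
Qed.

Lemma ad_dag_delta v : N (D v) = 0.
Proof.
apply: (bij_inj twist_bij).
by rewrite twist_ad_dag linear0 /delta addrC (Nij_T Hx).
Qed.

(** The terms of order [t] agree because [N] is a derivation; the term of order [t^2] vanishes by
    [ad_dag_bracket0]. *)
Lemma phi_bracket t y z : phi t (br y z) = br (phi t y) (phi t z).
Proof.
rewrite /= (ad_dag_bracket _ x_fix) linearDl !linearDr !linearZl_LR !linearZr.
by rewrite /= ad_dag_bracket0 !scaler0 addr0 scalerDr -!addrA [X in _ + X = _]addrC.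
Qed.

Lemma psi_act t y v : psi t (act y v) = act (phi t y) (psi t v).
Proof.
rewrite /= (rho_dag_act twist_bij _ x_fix) linearDl !linearDr !linearZl_LR.
rewrite !linearZr /= act_dag0 !scaler0 addr0 scalerDr -!addrA.
by rewrite [X in _ + X = _]addrC.
Qed.

Lemma ad_dag_deform t v : N (deform T D t v) = N (T v).
Proof. by rewrite /deform linearD linearZ /= ad_dag_delta scaler0 addr0. Qed.

Lemma deform_psi t v : T (psi t v) = phi t (deform T D t v).
Proof.
rewrite /= ad_dag_deform /deform linearD linearZ /=.
by rewrite (delta_dagE twist_bij _ x_fix HT) -addrA -scalerDr subrK.
Qed.

(** This is the order [t] part of the O-operator equation for [T + tD]. It comes from letting the
    derivations [N] and [R] act on the equation for [T]. *)
Lemma delta_cocycle u v :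
  br (T u) (D v) + br (D u) (T v) = T (skew_act M D u v) + D (skew_act M T u v).
Proof.
have dE := delta_dagE twist_bij beta_bij x_fix HT.
(* The product attached to [D] is the failure of [R] to be a derivation of the product attached to
   [T]. *)
have -> : skew_act M D u v
    = skew_act M T u (R v) + skew_act M T (R u) v - R (skew_act M T u v).
  apply/esym/(canLR (addrK _)); rewrite /skew_act [R (_ - _)]linearB /=.
  rewrite !(rho_dag_act twist_bij _ x_fix) !dE !linearBl /=.
  rewrite addrACA -opprD [in RHS]addrACA -opprD !addrA !subrK.
  by rewrite [in LHS]addrC [X in X - _]addrC addrC.
rewrite [D (skew_act _ _ _ _)]dE.
rewrite -(O_bracket HT) (ad_dag_bracket _ x_fix).
rewrite linearB [T (_ + _)]linearD.
rewrite -!(O_bracket HT) addrA subrK !dE linearBl linearBr.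
by rewrite opprD addrACA [- br (N _) _ - _]addrC.
Qed.

Lemma deform_bracket t u v :
  br (deform T D t u) (deform T D t v)
    = deform T D t (skew_act M (deform T D t) u v).
Proof.
set Tt := deform T D t; set P := skew_act M Tt u v.
(* Both sides become values of [T], and [psi t] carries the product of [deform T D t] to that of
   [T]. *)
have phiE : phi t (br (Tt u) (Tt v)) = phi t (Tt P).
  rewrite -[RHS]deform_psi phi_bracket -!deform_psi (O_bracket HT).
  congr (T _).
  rewrite !deform_psi -!psi_act opprD addrACA -scalerBr.
  by rewrite -[R _ - R _]linearB.
(* [phi t] need not be injective, but it is the identity plus [t *: N], so equality of the
   [N]-images lets the [N] terms cancel in [phiE]. *)
suff NE : N (br (Tt u) (Tt v)) = N (Tt P) by move: phiE; rewrite /= NE => /addIr.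
(* Apply [N] to the cocycle identity; every term containing [N (D _)] drops out. *)
have NTE : br (N (T u)) (D v) + br (D u) (N (T v)) = N (T (skew_act M D u v)).
  transitivity (N (br (T u) (D v) + br (D u) (T v))).
    rewrite [RHS]linearD /= !(ad_dag_bracket _ x_fix) !ad_dag_delta.
    by rewrite linear0l linear0r addr0 add0r.
  by rewrite delta_cocycle [LHS]linearD /= ad_dag_delta addr0.
(* Both sides are now affine in [t]: the constant terms agree by the O-operator equation for [T],
   the linear ones by [NTE]. *)
rewrite (ad_dag_bracket _ x_fix) !ad_dag_deform /P skew_act_deform.
rewrite [T (_ + _)]linearD [RHS]linearD !linearZ /= -NTE -(O_bracket HT).
rewrite (ad_dag_bracket _ x_fix) /Tt /deform linearDl linearDr.
by rewrite linearZl_LR linearZr /= addrACA scalerDr.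
Qed.

Lemma deform_O_operator t : O_operator M (deform T D t).
Proof.
split; [exact: deform_linear | | exact: deform_bracket].
by move=> v; rewrite /deform (O_beta HT) delta_beta [RHS]linearD linearZ.
Qed.

Lemma delta_linear_deformation : linear_deformation M T D.
Proof.
split; [exact: delta_linear | exact: delta_beta | exact: deform_O_operator].
Qed.

Lemma deform0 t v : deform T (fun=> 0) t v = T v.
Proof. by rewrite /deform scaler0 addr0. Qed.

Lemma deform0_O_operator t : O_operator M (deform T (fun=> 0) t).
Proof.
split=> [a u v|v|u v]; rewrite !deform0 ?linearP ?(O_beta HT) //.
exact: O_bracket HT _ _.
Qed.

Lemma delta_trivial_deformation : trivial_deformation twist_bij beta_bij T D.
Proof.
split; first exact: delta_linear_deformation.
  split=> [a u v|v|t]; rewrite ?scaler0 ?addr0 ?linear0 //.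
  exact: deform0_O_operator.
(* The Nijenhuis element itself gives the equivalence, through [phi t] and [psi t]. *)
exists x; first exact: x_fix.
move=> t; split.
- exact: deform_O_operator.
- exact: deform0_O_operator.
- exact: phi_linear.
- exact: phi_bracket.
- by move=> y; rewrite linearD linearZ /= twist_ad_dag ad_dag_twist ?x_fix.
- exact: psi_linear.
- by move=> v; rewrite deform0 deform_psi.
- by move=> v; rewrite linearD linearZ /= beta_rho_dag rho_dag_beta ?x_fix.
- exact: psi_act.
Qed.

End NijenhuisDeformation.

Theorem theorem4p5 (k : fieldType) (char0 : [pchar k] =i pred0)
  (g : lmodType k) (L : hom_lie g) (twist_bij : regular L)
  (V : lmodType k) (M : hom_lie_rep L V) (beta_bij : bijective (beta M))
  (T : V -> g) (HT : O_operator M T) (x : g) (Hx : Nij M T x) :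
  linear_deformation M T (delta beta_bij T x) /\
  trivial_deformation twist_bij beta_bij T (delta beta_bij T x).
Proof.
pose T' : {linear V -> g} :=
  HB.pack T (GRing.isLinear.Build k V g *:%R T (O_linear HT)).
split.
  exact: (delta_linear_deformation twist_bij beta_bij (T := T') HT Hx).
exact: (delta_trivial_deformation twist_bij beta_bij (T := T') HT Hx).
Qed.
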